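(* For any sentence $\Phi$ in $\mathrm{GMMSNP}_{\neq}$ (over some finite relational signature $\tau$) there exists a sentence $\Phi'$ in $\mathrm{MMSNP}$ (over some finite relational signature $\tau'$) such that the problems $\mathrm{Sat}(\Phi)$ and $\mathrm{Sat}(\Phi')$ are polynomial-time equivalent.
   Context: Let $\tau$ be a finite relational signature (the input symbols). An $\mathrm{SNP}$ $\tau$-sentence is written in the form $\exists X_1,\ldots,X_s\,\forall \mathbf{x}\,\bigwedge_i \neg(\alpha_i\wedge\beta_i\wedge\epsilon_i)$, where $\sigma=\{X_1,\dots,X_s\}$ are existentially quantified relation symbols (existential symbols), each $\alpha_i$ is a conjunction of atomic or negated atomic $\tau$-formulas, each $\beta_i$ is a conjunction of atomic or negated atomic $\sigma$-formulas, and each $\epsilon_i$ is a conjunction of inequalities $x\neq y$ between variables of $\mathbf{x}$; each subformula $\neg(\alpha_i\wedge\beta_i\wedge\epsilon_i)$ is a negated conjunct. $\mathrm{MMSNP}$ is the class of such sentences where all existential symbols are unary (monadic), every $\alpha_i$ contains no negated $\tau$-atoms (monotone), and every $\epsilon_i$ is empty. $\mathrm{GMMSNP}_{\neq}$ is the class of such sentences where each $\alpha_i$ is a conjunction of nonnegated $\tau$-atoms, each $\beta_i$ is a conjunction of unary $\sigma$-atoms or negated unary $\sigma$-atoms, and for every inequality $x\neq x'$ in each $\epsilon_i$ there is a $\tau$-atom in $\alpha_i$ containing both $x$ and $x'$. $\mathrm{Sat}(\Phi)$ denotes the set (decision problem) of finite $\tau$-structures satisfying $\Phi$. Two problems are polynomial-time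 equivalent if each is polynomial-time many-one reducible to the other. Sentences are assumed nontrivial (having both YES and NO finite instances). *)

(* Defs.v *)
From HB Require Import structures.
From mathcomp Require Import all_boot all_order all_algebra.

Set Implicit Arguments.
Unset Strict Implicit.
Unset Printing Implicit Defensive.

Record signature : Type := Signature {
  sym : finType;
  arity : sym -> nat
}.

(* Finite structures up to isomorphism: the universe is a nonempty initial
   segment of the natural numbers, as needed to encode structures by words. *)
Record structure (tau : signature) : Type := Structure {
  universe_size : nat;
  universe_gt0 : 0 < universe_size;
  interp : forall R : sym tau, {set (arity R).-tuple 'I_universe_size}
}.

Section Syntax.

Variables (tau : signature) (V : eqType).

Record atom : Type := Atom {
  rel : sym tau;
  args : (arity rel).-tuple V
}.

Record literal : Type := Literal {
  polarity : bool;
  lit_atom : atom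
}.

Definition atom_contains (a : atom) (x : V) : bool := x \in tval (args a).

Definition atom_holds (n : nat)
    (I : forall R : sym tau, {set (arity R).-tuple 'I_n}) (v : V -> 'I_n)
    (a : atom) : bool :=
  map_tuple v (args a) \in I (rel a).

Definition literal_holds (n : nat)
    (I : forall R : sym tau, {set (arity R).-tuple 'I_n}) (v : V -> 'I_n)
    (l : literal) : bool :=
  atom_holds I v (lit_atom l) == polarity l.

End Syntax.

(* The negated conjunct ~ (alpha /\ beta /\ epsilon), with variables in V; a
   pair (x, y) in epsilon stands for the inequality x <> y. *)
Record negated_conjunct (tau sigma : signature) (V : eqType) : Type :=
  NegatedConjunct {
    alpha : seq (literal tau V);
    beta : seq (literal sigma V);
    epsilon : seq (V * V)
  }.

Record SNP (tau : signature) : Type := MkSNP {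
  ex_sig : signature;
  nvars : nat;
  conjuncts : seq (negated_conjunct tau ex_sig 'I_nvars)
}.

Definition conjunct_holds (tau sigma : signature) (V : eqType) (n : nat)
    (I : forall R : sym tau, {set (arity R).-tuple 'I_n})
    (J : forall X : sym sigma, {set (arity X).-tuple 'I_n})
    (v : V -> 'I_n) (c : negated_conjunct tau sigma V) : bool :=
  ~~ [&& all (literal_holds I v) (alpha c),
         all (literal_holds J v) (beta c)
       & all (fun e => v e.1 != v e.2) (epsilon c)].

Definition Sat (tau : signature) (Phi : SNP tau) (A : structure tau) : Prop :=
  exists J : forall X : sym (ex_sig Phi), {set (arity X).-tuple 'I_(universe_size A)},
  forall v : 'I_(nvars Phi) -> 'I_(universe_size A),
    all (conjunct_holds (@interp tau A) J v) (conjuncts Phi).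

Definition nontrivial (tau : signature) (Phi : SNP tau) : Prop :=
  (exists A : structure tau, Sat Phi A) /\
  (exists A : structure tau, ~ Sat Phi A).

Definition monotone (tau sigma : signature) (V : eqType)
    (c : negated_conjunct tau sigma V) : bool :=
  all (@polarity tau V) (alpha c).

Definition MMSNP (tau : signature) (Phi : SNP tau) : Prop :=
  (forall X : sym (ex_sig Phi), arity X = 1) /\
  all (fun c => monotone c && nilp (epsilon c)) (conjuncts Phi).

Definition unary_beta (tau sigma : signature) (V : eqType)
    (c : negated_conjunct tau sigma V) : bool :=
  all (fun l : literal sigma V => arity (rel (lit_atom l)) == 1) (beta c).

Definition guarded (tau sigma : signature) (V : eqType)
    (c : negated_conjunct tau sigma V) : bool :=
  all (fun e : V * V =>
         has (fun l : literal tau V => atom_contains (lit_atom l) e.1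
                                       && atom_contains (lit_atom l) e.2)
             (alpha c))
      (epsilon c).

Definition GMMSNPneq (tau : signature) (Phi : SNP tau) : Prop :=
  all (fun c => [&& monotone c, unary_beta c & guarded c]) (conjuncts Phi).

(* Deterministic Turing machines with ntapes.+1 two-way infinite tapes.  In the
   tape alphabet, None is the blank, Some (inl b) an input/output bit, and
   Some (inr a) an auxiliary symbol.  The machine halts when delta is None. *)
Inductive move : Type := MoveLeft | Stay | MoveRight.

Definition tape_symbol (aux : finType) : finType := option (bool + aux).

Record machine : Type := Machine {
  ntapes : nat;
  aux : finType;
  state : finType;
  start : state;
  delta : state -> {ffun 'I_ntapes.+1 -> tape_symbol aux} ->
          option (state * {ffun 'I_ntapes.+1 -> tape_symbol aux * move})
}.

Record config (M : machine) : Type := Config {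
  cstate : state M;
  tape : 'I_(ntapes M).+1 -> int -> tape_symbol (aux M);
  head_pos : 'I_(ntapes M).+1 -> int
}.

Definition shift (m : move) (z : int) : int :=
  match m with
  | MoveLeft => (z - 1)%R
  | Stay => z
  | MoveRight => (z + 1)%R
  end.

Definition instruction (M : machine) (c : config M) :=
  delta (cstate c) [ffun i => tape c i (head_pos c i)].

Definition halted (M : machine) (c : config M) : bool := ~~ isSome (instruction c).

Definition step (M : machine) (c : config M) : config M :=
  if instruction c is Some (q, act) then
    Config q
      (fun i z => if z == head_pos c i then (act i).1 else tape c i z)
      (fun i => shift (act i).2 (head_pos c i))
  else c.

Definition word_tape (aux : finType) (w : seq bool) (z : int)
    : tape_symbol aux :=
  if z is Posz k then nth None [seq Some (inl b) | b <- w] k else None.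

(* The input is on the first tape, the output on the last one. *)
Definition init (M : machine) (w : seq bool) : config M :=
  Config (start M)
    (fun i => if i == ord0 then word_tape (aux M) w else fun=> None)
    (fun=> 0%R).

Definition outputs_within (M : machine) (w u : seq bool) (t : nat) : Prop :=
  let c := iter t (@step M) (init M w) in
  halted c /\ tape c ord_max =1 word_tape (aux M) u.

Definition poly_time (T U : Type) (encT : T -> seq bool) (encU : U -> seq bool)
    (f : T -> U) : Prop :=
  exists (M : machine) (p : {poly nat}), forall x : T,
    outputs_within M (encT x) (encU (f x)) (p.[size (encT x)])%R.

Fixpoint lex_tuples (n k : nat) : seq (k.-tuple 'I_n) :=
  if k is k'.+1 then
    [seq cons_tuple x t | x <- enum 'I_n, t <- lex_tuples n k']
  else [:: [tuple]].

(* The size of the universe in unary, followed by the characteristic vectors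
   of the relations, with tuples listed lexicographically. *)
Definition encode (tau : signature) (A : structure tau) : seq bool :=
  nseq (universe_size A) true ++ false ::
  flatten [seq [seq t \in interp A R | t <- lex_tuples (universe_size A) (arity R)]
          | R <- enum (sym tau)].

Definition poly_reducible (tau tau' : signature)
    (P : structure tau -> Prop) (Q : structure tau' -> Prop) : Prop :=
  exists2 f : structure tau -> structure tau',
    poly_time (@encode tau) (@encode tau') f &
    forall A : structure tau, P A <-> Q (f A).

Definition poly_equivalent (tau tau' : signature)
    (P : structure tau -> Prop) (Q : structure tau' -> Prop) : Prop :=
  poly_reducible P Q /\ poly_reducible Q P.

(* Main.v *)
Require Import Defs.
From HB Require Import structures.
From mathcomp Require Import all_boot all_order all_algebra zify.
From Stdlib Require Import FunctionalExtensionality.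
From Stdlib Require List.

(** Refine every input symbol R into symbols R_E, one for each equality pattern
    E of its arguments, and let R_E hold those tuples of R whose pattern is
    exactly E.  A negated conjunct splits into one copy for every identification
    p of its variables that respects its inequalities: an atom R(x) becomes
    R_E(p x) with E the pattern of p x, and since each inequality is guarded by
    such an atom, it can be dropped.  This is correct as long as no tuple of R_E
    has equal entries where E separates them, a condition that a monotone
    conjunct without inequalities can impose.  Conversely, a structure B over
    the refined signature that violates this condition is a NO instance, and
    any other B comes from the structure in which R is the set of the tuples
    that lie in R_E for their own pattern E.

    Both reductions are computed by loops over all tuples in lexicographic
    order.  The machine keeps the entries t_i of the current tuple as head
    positions on counter tapes, and one extra tape for every pair (i, j), whose
    head stands at t_i - t_j; thus the equality pattern of the tuple can be read
    off the scanned symbols in a single step. *)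

Set Implicit Arguments.
Unset Strict Implicit.
Unset Printing Implicit Defensive.

(** * Refinement by equality patterns *)

Lemma all_has_exists2 (T : Type) (P a : pred T) (s : seq T) :
  all P s -> has a s -> exists2 x, P x & a x.
Proof.
elim: s => //= x s IHs /andP[Px Ps] /orP[ax|]; first by exists x.
exact: IHs.
Qed.

(** Membership is [List.In] because conjuncts carry no [eqType] structure. *)
Lemma all_In (T : Type) (P : pred T) (s : seq T) :
  all P s <-> (forall x, List.In x s -> P x).
Proof.
elim: s => //= x s [IH1 IH2]; split=> [/andP[Px /IH1 h] y [<-|/h]|h] //.
by rewrite h ?IH2 //; [move=> y ys; apply: h; right|left].
Qed.

Lemma all_flatten (T : Type) (P : pred T) (ss : seq (seq T)) :
  all P (flatten ss) = all (all P) ss.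
Proof. by elim: ss => //= s ss IHs; rewrite all_cat IHs. Qed.

Section Patterns.

Variable tau : signature.

(** The successor makes ['I_width] inhabited even if all symbols are nullary; the prologue relies on
    at least one counter. *)
Definition width : nat := (\max_(R : sym tau) arity R).+1.

Definition pattern : finType := {ffun 'I_width * 'I_width -> bool}.

(* Positions beyond the end of s read as None, hence are equal to each other
   and to no entry: the pattern also determines the size of s. *)
Definition eqpat (T : eqType) (s : seq T) : pattern :=
  [ffun ij : 'I_width * 'I_width => onth s ij.1 == onth s ij.2].

(** The test is one-sided: an equality that [E] asks for may fail in [s]. A monotone conjunct
    without inequalities can only forbid a pattern together with all its further identifications. *)
Definition collapsed (E : pattern) (T : eqType) (s : seq T) : bool :=
  [exists ij, eqpat s ij && ~~ E ij].

Definition refined_sig : signature :=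
  @Signature (sym tau * pattern)%type (fun Q => arity Q.1).

Lemma arity_width (R : sym tau) : arity R < width.
Proof. by rewrite ltnS (leq_bigmax R). Qed.

Lemma eqpat_map (T U : eqType) (f : T -> U) (s : seq T) ij :
  eqpat s ij -> eqpat (map f s) ij.
Proof. by rewrite !ffunE !onth_map => /eqP ->. Qed.

(** A map never destroys equalities, so the pattern can only change by gaining one, and that is a
    collapse. *)
Lemma not_collapsed_map (T U : eqType) (f : T -> U) (s : seq T) :
  ~~ collapsed (eqpat s) (map f s) -> eqpat (map f s) = eqpat s.
Proof.
move=> h; apply/ffunP => ij; apply/idP/idP; last exact: eqpat_map.
move=> e; apply: contraR h => h; apply/existsP; exists ij; exact/andP.
Qed.

Lemma eqpat_map_in (T U : eqType) (f : T -> U) (s : seq T) :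
  {in s &, injective f} -> eqpat (map f s) = eqpat s.
Proof.
move=> f_inj; apply/ffunP => ij; apply/idP/idP; last exact: eqpat_map.
rewrite !ffunE !onth_map.
case ei: (onth s ij.1) => [x|]; case ej: (onth s ij.2) => [y|] //=.
move/eqP => -[/f_inj ->] //; apply/onthP; [by exists ij.1|by exists ij.2].
Qed.

Lemma collapsed_eqpat (T : eqType) (s : seq T) : ~~ collapsed (eqpat s) s.
Proof. by apply/existsPn => ij; case: (eqpat s ij). Qed.

End Patterns.

(** * The refined sentence and its models *)

Section Sentence.

Variables (tau : signature) (Phi : SNP tau).

Let tau' := refined_sig tau.
Let sigma := ex_sig Phi.

(* The arity of an existential symbol that occurs in no conjunct is arbitrary,
   so all arities are reset to 1. *)
Definition unary_sig : signature := @Signature (sym sigma) (fun=> 1).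
(* Room for the values of all variables of a conjunct, and for the entries of
   any tuple of an input relation. *)
Definition wide_nvars : nat := (nvars Phi + width tau).+1.

Definition refined_literal (p : 'I_(nvars Phi) -> 'I_wide_nvars)
    (l : literal tau 'I_(nvars Phi)) : literal tau' 'I_wide_nvars :=
  Literal (polarity l)
    (@Atom tau' _ (Defs.rel (lit_atom l), eqpat tau (map p (args (lit_atom l))))
       (map_tuple p (args (lit_atom l)))).

(** On an atom of arity 1, [head] returns the only variable; [unary_beta] keeps the default [ord0]
    from being reached. *)
Definition unary_literal (p : 'I_(nvars Phi) -> 'I_wide_nvars)
    (l : literal sigma 'I_(nvars Phi)) : literal unary_sig 'I_wide_nvars :=
  Literal (polarity l)
    (@Atom unary_sig _ (Defs.rel (lit_atom l))
       [tuple head ord0 (map p (args (lit_atom l)))]).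

Definition refined_conjunct (c : negated_conjunct tau sigma 'I_(nvars Phi))
    (p : 'I_(nvars Phi) -> 'I_wide_nvars) : negated_conjunct tau' unary_sig 'I_wide_nvars :=
  NegatedConjunct (map (refined_literal p) (alpha c))
    (map (unary_literal p) (beta c)) [::].

Definition forbidden_atom (Q : sym tau') (q : (arity Q).-tuple 'I_wide_nvars) :
    negated_conjunct tau' unary_sig 'I_wide_nvars :=
  NegatedConjunct [:: Literal true (Atom q)] [::] [::].

Definition refined_SNP : SNP tau' :=
  MkSNP
    (flatten [seq [seq refined_conjunct c p |
                   p : {ffun 'I_(nvars Phi) -> 'I_wide_nvars} <-
                     enum {ffun 'I_(nvars Phi) -> 'I_wide_nvars}
                   & all (fun e => p e.1 != p e.2) (epsilon c)]
             | c <- conjuncts Phi] ++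
     flatten [seq [seq forbidden_atom q |
                   q : (arity Q).-tuple 'I_wide_nvars <-
                     enum {: (arity Q).-tuple 'I_wide_nvars} & collapsed Q.2 q]
             | Q <- enum (sym tau')]).

Lemma refined_SNP_all (P : pred (negated_conjunct tau' unary_sig 'I_wide_nvars)) :
  all P (conjuncts refined_SNP) <->
  (forall c, List.In c (conjuncts Phi) ->
   forall p : {ffun 'I_(nvars Phi) -> 'I_wide_nvars},
   all (fun e => p e.1 != p e.2) (epsilon c) -> P (refined_conjunct c p)) /\
  (forall (Q : sym tau') (q : (arity Q).-tuple 'I_wide_nvars),
   collapsed Q.2 q -> P (forbidden_atom q)).
Proof.
rewrite /refined_SNP all_cat !all_flatten; split.
  rewrite all_map => /andP[/all_In h1]; rewrite all_map => /allP h2; split=> [c cP p ep|Q q Qq].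
    have := h1 c cP; rewrite [preim _ _ _]/= all_map => /allP /(_ p); apply.
    by rewrite mem_filter ep mem_enum.
  have := h2 Q; rewrite mem_enum => /(_ isT).
  rewrite [preim _ _ _]/= all_map => /allP /(_ q); apply.
  by rewrite mem_filter Qq mem_enum.
case=> h1 h2; apply/andP; split.
  rewrite all_map; apply/all_In => c cP; rewrite [preim _ _ _]/= all_map; apply/allP => p.
  by rewrite mem_filter => /andP[ep _]; apply: h1.
rewrite all_map; apply/allP => Q _; rewrite [preim _ _ _]/= all_map; apply/allP => q.
by rewrite mem_filter => /andP[Qq _]; apply: h2.
Qed.

Hypothesis PhiP : GMMSNPneq Phi.

Lemma refined_MMSNP : MMSNP refined_SNP.
Proof.
split=> //; apply/refined_SNP_all; split=> // c cP p _.
have /and3P[mc _ _] := (all_In _ _).1 PhiP c cP.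
by rewrite andbT /monotone /= all_map; apply: sub_all mc.
Qed.

Section Model.

Variables (n : nat) (a0 : 'I_n).
Variables (I : forall R : sym tau, {set (arity R).-tuple 'I_n})
          (I' : forall Q : sym tau', {set (arity Q).-tuple 'I_n}).

Hypothesis II' : forall (R : sym tau) (t : (arity R).-tuple 'I_n),
  (t \in I R) = (t \in I' (R, eqpat tau t)).

Lemma refined_literal_holds (v : 'I_wide_nvars -> 'I_n) p
    (l : literal tau 'I_(nvars Phi)) :
  eqpat tau (map v (map p (args (lit_atom l)))) =
    eqpat tau (map p (args (lit_atom l))) ->
  literal_holds I' v (refined_literal p l) =
  literal_holds I (fun x => v (p x)) l.
Proof.
move=> e; rewrite /literal_holds /atom_holds /= II'.
have -> : map_tuple (fun x => v (p x)) (args (lit_atom l)) =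
    map_tuple v (map_tuple p (args (lit_atom l))).
  by apply: val_inj => /=; rewrite -map_comp.
by rewrite /= e.
Qed.

Lemma unary_literal_holds (v : 'I_wide_nvars -> 'I_n) p
    (J : forall X : sym sigma, {set (arity X).-tuple 'I_n})
    (J' : forall X : sym unary_sig, {set (arity X).-tuple 'I_n})
    (l : literal sigma 'I_(nvars Phi)) :
  (forall (X : sym sigma) (t : (arity X).-tuple 'I_n) a, tval t = [:: a] ->
     (t \in J X) = ([tuple a] \in J' X)) ->
  arity (Defs.rel (lit_atom l)) = 1 ->
  literal_holds J' v (unary_literal p l) =
  literal_holds J (fun x => v (p x)) l.
Proof.
move=> JJ'; case: l => pol [X w] /= X1.
rewrite /literal_holds /atom_holds /=; congr (_ == _).
have /= := size_tuple w; rewrite [RHS in _ = RHS]X1.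
case ew: (tval w) => [|x [|]] // _.
have h : tval (map_tuple (fun x => v (p x)) w) = [:: v (p x)] by rewrite /= ew.
rewrite (JJ' _ _ _ h); apply: (congr1 (fun t => t \in J' X)).
by apply: val_inj.
Qed.

Hypothesis I'P : forall (Q : sym tau') (t : (arity Q).-tuple 'I_n),
  t \in I' Q -> ~~ collapsed Q.2 t.

(** If [v] violates the refined conjunct, then [v] composed with [p] violates [c]: no atom of
    [alpha c] is collapsed by [v], and each inequality lives inside such an atom. *)
Lemma conjunct_holds_refined
    (J : forall X : sym sigma, {set (arity X).-tuple 'I_n})
    (J' : forall X : sym unary_sig, {set (arity X).-tuple 'I_n}) c
    (p : {ffun 'I_(nvars Phi) -> 'I_wide_nvars}) (v : 'I_wide_nvars -> 'I_n) :
  (forall (X : sym sigma) (t : (arity X).-tuple 'I_n) a, tval t = [:: a] ->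
     (t \in J X) = ([tuple a] \in J' X)) ->
  List.In c (conjuncts Phi) ->
  all (fun e => p e.1 != p e.2) (epsilon c) ->
  conjunct_holds I J (fun x => v (p x)) c ->
  conjunct_holds I' J' v (refined_conjunct c p).
Proof.
move=> JJ' cP ep; apply: contraNN => /and3P[ha hb _].
have /and3P[mc uc gc] := (all_In _ _).1 PhiP c cP.
move: ha hb; rewrite /= !all_map => ha hb.
(* Each literal is positive, so its refined atom really holds in [I'], and [I'P] forces [v] to
   preserve the pattern of its arguments. *)
have {}ha : all (fun l => literal_holds I (fun x => v (p x)) l &&
    (eqpat tau (map v (map p (args (lit_atom l)))) ==
     eqpat tau (map p (args (lit_atom l))))) (alpha c).
  have : all (predI (@polarity _ _) (preim (refined_literal p) (literal_holds I' v)))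
      (alpha c) by rewrite all_predI; apply/andP.
  apply: sub_all => l /= /andP[pl hl].
  have e : eqpat tau (map v (map p (args (lit_atom l)))) =
      eqpat tau (map p (args (lit_atom l))).
    apply: not_collapsed_map.
    by move: hl; rewrite /literal_holds /= pl eqb_id => /I'P.
  by rewrite -refined_literal_holds // hl e eqxx.
apply/and3P; split.
- by apply: sub_all ha => l /andP[].
- have : all (predI (fun l => arity (Defs.rel (lit_atom l)) == 1)
      (preim (unary_literal p) (literal_holds J' v))) (beta c).
    by rewrite all_predI; apply/andP.
  apply: sub_all => l /= /andP[/eqP l1].
  by rewrite (@unary_literal_holds v p J J').
- apply/allP => e ec; apply: contraNneq (allP ep _ ec) => ve.
  have [l /andP[_ /eqP hl] /andP[e1 e2]] := all_has_exists2 ha (allP gc _ ec).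
  rewrite /atom_contains in e1 e2; set s := tval _ in e1 e2 hl.
  have sw x : x \in s -> index x s < width tau.
    by rewrite -index_mem size_tuple => /ltn_trans; apply; apply: arity_width.
  have on x : x \in s -> onth s (index x s) = Some x.
    by move=> xs; rewrite onthE (nth_map x) ?index_mem ?nth_index.
  (* The two equal patterns are compared at the first occurrences of the two variables in the guard:
     equal values under [v] give equal images under [p]. *)
  have := congr1 (fun E : pattern tau => E (Ordinal (sw _ e1), Ordinal (sw _ e2))) hl.
  by rewrite !ffunE /= !onth_map !on //= ve eqxx => /esym/eqP [->].
Qed.

(** A violating [v] factors through its own kernel: [p] sends a variable to the index of its value
    in [codom v], and [v'] reads the value back. Since [v'] is injective on the image of [p],
    inequalities and patterns carry over. *)
Lemma conjunct_holds_unrefined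
    (J : forall X : sym sigma, {set (arity X).-tuple 'I_n})
    (J' : forall X : sym unary_sig, {set (arity X).-tuple 'I_n}) c
    (v : 'I_(nvars Phi) -> 'I_n) :
  (forall (X : sym sigma) (t : (arity X).-tuple 'I_n) a, tval t = [:: a] ->
     (t \in J X) = ([tuple a] \in J' X)) ->
  List.In c (conjuncts Phi) ->
  (forall v' (p : {ffun 'I_(nvars Phi) -> 'I_wide_nvars}),
     all (fun e => p e.1 != p e.2) (epsilon c) ->
     conjunct_holds I' J' v' (refined_conjunct c p)) ->
  conjunct_holds I J v c.
Proof.
move=> JJ' cP h; apply/negP => /and3P[ha hb he].
have /and3P[mc uc gc] := (all_In _ _).1 PhiP c cP.
pose p := [ffun x => inord (index (v x) (codom v)) : 'I_wide_nvars].
pose v' (z : 'I_wide_nvars) := nth a0 (codom v) z.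
have v'p x : v' (p x) = v x.
  rewrite /v' ffunE inordK ?nth_index ?codom_f //.
  have := codom_f v x; rewrite -index_mem size_codom card_ord => /ltn_trans.
  by apply; rewrite ltnS leq_addr.
have pe : all (fun e => p e.1 != p e.2) (epsilon c).
  by apply: sub_all he => e; apply: contraNneq => pe; rewrite -!v'p pe.
have ev : (fun x => v' (p x)) = v by apply: functional_extensionality.
have /negP := h v' p pe; apply; apply/and3P; split=> //=; rewrite all_map.
  apply: sub_all ha => l hl /=; rewrite refined_literal_holds ?ev //.
  apply: eqpat_map_in => _ _ /mapP[x _ ->] /mapP[y _ ->].
  by rewrite !v'p => vxy; rewrite !ffunE vxy.
have : all (predI (fun l => arity (Defs.rel (lit_atom l)) == 1)
    (literal_holds J v)) (beta c) by rewrite all_predI; apply/andP.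
by apply: sub_all => l /= /andP[/eqP l1]; rewrite (@unary_literal_holds v' p J J') // ev.
Qed.

Lemma refined_models :
  (exists J : forall X : sym sigma, {set (arity X).-tuple 'I_n},
     forall v, all (conjunct_holds I J v) (conjuncts Phi)) <->
  (exists J : forall X : sym unary_sig, {set (arity X).-tuple 'I_n},
     forall v, all (conjunct_holds I' J v) (conjuncts refined_SNP)).
Proof.
split=> -[J hJ].
  (* For arity 1 the constant tuple is [t] itself; for any other arity, which no conjunct uses, it
     only provides a tuple of the right length. *)
  pose J' (X : sym unary_sig) : {set 1.-tuple 'I_n} :=
    [set t | [tuple of nseq (@arity sigma X) (thead t)] \in J X].
  have JJ' (X : sym sigma) (t : (arity X).-tuple 'I_n) a : tval t = [:: a] ->
     (t \in J X) = ([tuple a] \in J' X).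
    move=> ta; rewrite inE; apply: (congr1 (fun t => t \in J X)); apply: val_inj => /=.
    have := size_tuple t; rewrite ta /= => <-.
    by rewrite /thead (tnth_nth a).
  exists J' => v; apply/refined_SNP_all; split=> [c cP p ep|Q q Qq].
    apply: (conjunct_holds_refined JJ' cP ep).
    exact: (all_In _ _).1 (hJ _) c cP.
  apply/negP => /and3P[/= ha _ _]; move: ha; rewrite andbT /literal_holds eqb_id.
  move/I'P/existsPn; case/existsP: Qq => ij /andP[qij nE] /(_ ij).
  by rewrite /= (eqpat_map _ qij) nE.
pose J' (X : sym sigma) : {set (arity X).-tuple 'I_n} :=
  [set t | [exists a, (tval t == [:: a]) && ([tuple a] \in J X)]].
exists J' => v; apply/all_In => c cP; apply: (conjunct_holds_unrefined (J := J') (J' := J) _ _ cP).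
  move=> X t a ta; rewrite inE; apply/existsP/idP => [[b]|]; last first.
    by move=> h; exists a; rewrite ta eqxx.
  by rewrite ta => /andP[/eqP[->]].
move=> v' p ep; have [h _] := (refined_SNP_all _).1 (hJ v'); exact: h.
Qed.

End Model.

(** Naming each entry of [t] by its first position in [t] gives a tuple [q] of variables with the
    equalities of [t], so [q] is collapsed too, and its forbidden atom is violated by the assignment
    that reads the entries back. *)
Lemma collapsed_unsat n (a0 : 'I_n)
    (I' : forall Q : sym tau', {set (arity Q).-tuple 'I_n})
    (Q : sym tau') (t : (arity Q).-tuple 'I_n) :
  t \in I' Q -> collapsed Q.2 t ->
  ~ (exists J : forall X : sym unary_sig, {set (arity X).-tuple 'I_n},
     forall v, all (conjunct_holds I' J v) (conjuncts refined_SNP)).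
Proof.
move=> tI /existsP[ij /andP[tij nE]] [J hJ].
pose q := map_tuple (fun x => inord (index x t) : 'I_wide_nvars) t.
pose v (z : 'I_wide_nvars) := nth a0 t z.
have vq : map_tuple v q = t.
  apply: val_inj; rewrite /= -map_comp -[RHS]map_id; apply/eq_in_map => x xt /=.
  rewrite /v inordK ?nth_index //.
  have := xt; rewrite -index_mem size_tuple => /ltn_trans; apply.
  by apply: (leq_trans (arity_width Q.1)); rewrite leqW // leq_addl.
have [_ /(_ Q q)] := (refined_SNP_all _).1 (hJ v).
have -> : collapsed Q.2 q by apply/existsP; exists ij; rewrite eqpat_map.
move=> /(_ isT)/negP h; apply: h; rewrite /= !andbT /literal_holds /atom_holds eqb_id.
by have -> : map_tuple v (args (lit_atom (Literal true (Atom q)))) = t by [].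
Qed.

End Sentence.

(** * While-programs and Turing machines *)

Notation symb := (tape_symbol void).

Section Programs.

Variable T : finType.

Definition tapes := T -> (int -> symb) * int.
Definition scan (s : tapes) (x : T) : symb := (s x).1 (s x).2.

Definition perform (a : T -> symb * move) (s : tapes) : tapes :=
  fun x => (fun z => if z == (s x).2 then (a x).1 else (s x).1 z,
            shift (a x).2 (s x).2).

(* While-programs over tapes indexed by T; an action rewrites the scanned
   symbols and moves the heads as a function of all scanned symbols. *)
Inductive program : Type :=
| Act of (T -> symb) -> T -> symb * move
| Seq of program & program
| While of (T -> symb) -> bool & program.

(** Control points: [None] in a loop is its test, and [inl] and [inr] are the two halves of a
    sequence. Exit is no point but the outer [None] in [advance]. *)
Fixpoint point (c : program) : finType :=
  match c with
  | Act _ => unit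
  | Seq c1 c2 => (point c1 + point c2)%type
  | While _ c => option (point c)
  end.

Fixpoint entry (c : program) : point c :=
  match c with
  | Act _ => tt
  | Seq c1 _ => inl (entry c1)
  | While _ _ => None
  end.

Fixpoint next (c : program) :
    point c -> (T -> symb) -> option (point c) * (T -> symb * move) :=
  match c with
  | Act a => fun _ y => (None, a y)
  | Seq c1 c2 => fun q y =>
      match q with
      | inl q1 => let: (o, a) := next q1 y in
                  (Some (if o is Some q1' then inl q1' else inr (entry c2)), a)
      | inr q2 => let: (o, a) := next q2 y in (omap inr o, a)
      end
  | While b c1 => fun q y =>
      if q is Some q1 then let: (o, a) := next q1 y in (Some o, a)
      else (if b y then Some (Some (entry c1)) else None, fun x => (y x, Stay))
  end.

Definition advance (c : program) (k : option (point c) * tapes) :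
    option (point c) * tapes :=
  if k.1 is Some q then
    let: (o, a) := next q (scan k.2) in (o, perform a k.2)
  else k.

(* An exited program is stuck, so that n is only an upper bound. *)
Definition runs (c : program) (s s' : tapes) (n : nat) : Prop :=
  iter n (@advance c) (Some (entry c), s) = (None, s').

Lemma perform_stay (s : tapes) : perform (fun x => (scan s x, Stay)) s = s.
Proof.
apply: functional_extensionality => x; rewrite /perform /scan /=.
case: (s x) => f z /=; congr pair; apply: functional_extensionality => z'.
by case: eqP => // ->.
Qed.

Lemma advance_exited (c : program) (s : tapes) (n : nat) :
  iter n (@advance c) (None, s) = (None, s).
Proof. by elim: n => //= n ->. Qed.

Lemma runs_leq (c : program) (s s' : tapes) (m n : nat) :
  m <= n -> runs c s s' m -> runs c s s' n.
Proof. by move=> mn e; rewrite /runs -(subnK mn) iterD e advance_exited. Qed.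

Lemma runs_act (a : (T -> symb) -> T -> symb * move) (s s' : tapes) :
  perform (a (scan s)) s = s' -> runs (Act a) s s' 1.
Proof. by move=> <-. Qed.

(** Only some [m <= n] is claimed, because [c1] may exit early, and the sequence then moves on
    instead of getting stuck. *)
Lemma seq_left (c1 c2 : program) (s s' : tapes) (n : nat) (q : point c1) :
  iter n (@advance c1) (Some q, s) = (None, s') ->
  exists2 m, m <= n &
    iter m (@advance (Seq c1 c2)) (Some (inl q), s) = (Some (inr (entry c2)), s').
Proof.
elim: n q s => [|n IHn] q s //; rewrite iterSr {2}/advance /=.
case e: (next q (scan s)) => [[q'|] a] h.
  have [m mn hm] := IHn _ _ h; exists m.+1 => //.
  by rewrite iterSr {2}/advance /= e.
exists 1 => //; rewrite /= /advance /= e.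
by move: h; rewrite advance_exited => -[->].
Qed.

Lemma seq_right (c1 c2 : program) (n : nat) (o : option (point c2)) (s : tapes) :
  iter n (@advance (Seq c1 c2)) (omap inr o, s) =
  (omap inr (iter n (@advance c2) (o, s)).1, (iter n (@advance c2) (o, s)).2).
Proof.
elim: n => //= n ->; case: (iter _ _ _) => -[q|] s' //=.
by rewrite /advance /=; case: (next q (scan s')).
Qed.

Lemma runs_seq (c1 c2 : program) (s1 s2 s3 : tapes) (n1 n2 : nat) :
  runs c1 s1 s2 n1 -> runs c2 s2 s3 n2 -> runs (Seq c1 c2) s1 s3 (n1 + n2).
Proof.
move=> h1 h2; have [m mn hm] := seq_left c2 h1.
apply: (@runs_leq _ _ _ (n2 + m)); first by rewrite addnC leq_add2r.
by rewrite /runs iterD hm (seq_right c1 n2 (Some (entry c2))) h2.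
Qed.

Lemma while_body (b : (T -> symb) -> bool) (c : program) (s s' : tapes) (n : nat)
    (q : point c) :
  iter n (@advance c) (Some q, s) = (None, s') ->
  exists2 m, m <= n &
    iter m (@advance (While b c)) (Some (Some q), s) = (Some None, s').
Proof.
elim: n q s => [|n IHn] q s //; rewrite iterSr {2}/advance /=.
case e: (next q (scan s)) => [[q'|] a] h.
  have [m mn hm] := IHn _ _ h; exists m.+1 => //.
  by rewrite iterSr {2}/advance /= e.
exists 1 => //; rewrite /= /advance /= e.
by move: h; rewrite advance_exited => -[->].
Qed.

(** The family [f] of states before each test replaces an invariant. Every round costs one test on
    top of [t], and the failing test adds a last step. *)
Lemma runs_while (b : (T -> symb) -> bool) (c : program) (f : nat -> tapes)
    (m t : nat) :
  (forall i, i < m -> b (scan (f i))) -> ~~ b (scan (f m)) ->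
  (forall i, i < m -> runs c (f i) (f i.+1) t) ->
  runs (While b c) (f 0) (f m) (m * t.+1).+1.
Proof.
elim: m f => [|m IHm] f ht hf hc.
  by rewrite /runs /= /advance /= (negbTE hf) perform_stay.
have h := IHm (fun i => f i.+1) (fun i => ht i.+1) hf (fun i => hc i.+1).
have [k kt hk] := while_body b (hc 0 isT).
apply: (@runs_leq _ _ _ ((m * t.+1).+1 + k.+1)).
  by rewrite mulSn addSn ltnS addnC leq_add2r ltnS.
have e : iter k.+1 (@advance (While b c)) (Some None, f 0) = (Some None, f 1).
  by rewrite iterSr {2}/advance /= ht // perform_stay.
by rewrite /runs iterD e.
Qed.

(** The empty sequence is an idle action of one step, whence the [+ 1] in later time bounds. *)
Definition seqs (cs : seq program) : program :=
  foldr Seq (Act (fun y x => (y x, Stay))) cs.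

Lemma runs_nil (s : tapes) : runs (seqs [::]) s s 1.
Proof. by apply: runs_act; rewrite perform_stay. Qed.

(** * Compilation of programs into Turing machines *)

Variables (m : nat) (tape_of : 'I_m.+1 -> T) (index_of : T -> 'I_m.+1).
Hypothesis index_ofK : cancel index_of tape_of.

Definition compile (c : program) : machine :=
  @Machine m void (option (point c)) (Some (entry c))
    (fun o y =>
       if o is Some q then
         let: (o', a) := next q (fun x => y (index_of x)) in
         Some (o', [ffun i => a (tape_of i)])
       else None).

Definition machine_config (c : program) (k : option (point c) * tapes) :
    config (compile c) :=
  @Config (compile c) k.1 (fun i => (k.2 (tape_of i)).1)
    (fun i => (k.2 (tape_of i)).2).

Lemma instruction_config (c : program) (k : option (point c) * tapes) :
  instruction (machine_config k) =
  if k.1 is Some q then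
    Some ((next q (scan k.2)).1, [ffun i => (next q (scan k.2)).2 (tape_of i)])
  else None.
Proof.
rewrite /instruction /=; case: k => -[q|] s //=.
have ->: (fun x => [ffun i => (s (tape_of i)).1 (s (tape_of i)).2] (index_of x)) =
    scan s.
  by apply: functional_extensionality => x; rewrite ffunE index_ofK.
by case: (next q (scan s)).
Qed.

Lemma step_config (c : program) (k : option (point c) * tapes) :
  step (machine_config k) = machine_config (advance k).
Proof.
rewrite /step instruction_config /advance; case: k => -[q|] s //=.
case: (next q (scan s)) => o a /=; rewrite /machine_config /=; congr Config.
  apply: functional_extensionality => i; apply: functional_extensionality => z.
  by rewrite ffunE.
by apply: functional_extensionality => i; rewrite ffunE.
Qed.

Lemma compile_outputs (c : program) (s : tapes) (w u : seq bool) (t : nat) :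
  runs c (fun x => (if x == tape_of ord0 then word_tape void w else fun=> None, 0%R))
    s t ->
  injective tape_of ->
  (s (tape_of ord_max)).1 = word_tape void u ->
  outputs_within (compile c) w u t.
Proof.
move=> h inj hu.
have e : init (compile c) w = machine_config (Some (entry c),
    fun x => (if x == tape_of ord0 then word_tape void w else fun=> None, 0%R)).
  rewrite /init /machine_config /=; congr Config.
  by apply: functional_extensionality => i; rewrite (inj_eq inj).
have {}h : iter t (@step (compile c)) (init (compile c) w) = machine_config (None, s).
  rewrite e -h; elim: t {h} => //= t ->; exact: step_config.
by rewrite /outputs_within h /halted instruction_config /= hu.
Qed.

End Programs.

(** * Loops over tuples *)

Notation word := (word_tape void).

Lemma word_nth (w : seq bool) (k : nat) :
  word w k = if k < size w then Some (inl (nth false w k)) else None.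
Proof.
rewrite /word_tape; case: ltnP => kw; first by rewrite (nth_map false).
by rewrite nth_default ?size_map.
Qed.

Lemma word_true (w : seq bool) (k : nat) :
  (word w k == Some (inl true)) = nth false w k.
Proof.
rewrite word_nth; case: ltnP => kw; last by rewrite nth_default.
by case: (nth _ _ _).
Qed.

Definition put (o : option symb) (f : int -> symb) (z0 : int) : int -> symb :=
  if o is Some a then fun z => if z == z0 then a else f z else f.

(** Covers both overwriting and appending: if [v] is empty, so is [behead v], and the word grows. *)
Lemma put_word (u v : seq bool) (b : bool) :
  put (Some (Some (inl b))) (word (u ++ v)) (size u) = word (u ++ b :: behead v).
Proof.
apply: functional_extensionality => -[k|k] //=; rewrite eqz_nat.
rewrite !map_cat /= !nth_cat !size_map.
case: (ltngtP k (size u)) => // [uk|->]; last by rewrite subnn.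
by rewrite -[k - size u]prednK ?subn_gt0 //= -nth_behead behead_map.
Qed.

Lemma put_word_end (u : seq bool) (b : bool) :
  put (Some (Some (inl b))) (word u) (size u) = word (rcons u b).
Proof. by rewrite -{1}[u]cats0 put_word cats1. Qed.

Lemma put_blank (u : seq bool) (b : bool) :
  put (Some None) (word (rcons u b)) (size u) = word u.
Proof.
apply: functional_extensionality => -[k|k] //=; rewrite eqz_nat.
rewrite map_rcons nth_rcons size_map.
case: ltngtP => // uk; rewrite nth_default ?size_map //; first exact: ltnW.
by rewrite uk.
Qed.

Arguments put : simpl never.

Fixpoint lex_seqs (n k : nat) : seq (seq nat) :=
  if k is k'.+1 then [seq x :: l | x <- iota 0 n, l <- lex_seqs n k'] else [:: [::]].

Lemma lex_seqs_tuples (n k : nat) :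
  [seq [seq val x | x <- tval t] | t <- lex_tuples n k] = lex_seqs n k.
Proof.
elim: k => //= k <-; rewrite -val_enum_ord allpairs_mapl allpairs_mapr map_allpairs.
by [].
Qed.

(** * Tape layout, elementary actions and nested loops *)

Section Tapes.

Variable tau : signature.
Notation K := (width tau).

(* None is the input tape, Some None the output tape; then come a flag, the
   counters t_i, and for each (i, j) a tape whose head is at t_i - t_j. *)
Definition tape_name : finType := option (option (option ('I_K + 'I_K * 'I_K))).

Notation counter i := (Some (Some (Some (inl i))) : tape_name).

(* W is the input, f the content of the output tape, p and q their head
   positions, and h the positions of the counters.  If dm is set, cell 0 of
   each offset tape is marked, so that t_i = t_j iff the mark is scanned. *)
Definition layout (W : seq bool) (p : int) (f : int -> symb) (q : int) (fl : bool)
    (n : nat) (dm : bool) (h : 'I_K -> int) : tapes tape_name :=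
  fun x => match x with
  | None => (word W, p)
  | Some None => (f, q)
  | Some (Some None) => (word (nseq fl true), 0%R)
  | Some (Some (Some (inl i))) => (word (nseq n true), h i)
  | Some (Some (Some (inr (i, j)))) => (word (nseq dm true), (h i - h j)%R)
  end.

Definition tape_action (mi : move) (wo : option symb) (mo : move)
    (wf wi wd : option symb) (mx : 'I_K -> move) (md : 'I_K -> 'I_K -> move)
    (y : tape_name -> symb) (x : tape_name) : symb * move :=
  match x with
  | None => (y x, mi)
  | Some None => (odflt (y x) wo, mo)
  | Some (Some None) => (odflt (y x) wf, Stay)
  | Some (Some (Some (inl i))) => (odflt (y x) wi, mx i)
  | Some (Some (Some (inr (i, j)))) => (odflt (y x) wd, md i j)
  end.

Lemma perform_put (f : int -> symb) (o : option symb) (z0 : int) :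
  (fun z => if z == z0 then odflt (f z0) o else f z) = put o f z0.
Proof.
apply: functional_extensionality => z; case: o => //=.
by case: eqP => [->|].
Qed.

Lemma perform_tape_action W p f q (fl : bool) n (dm : bool) (h : 'I_K -> int) mi wo mo wf
    wi wd mx md (fl' : bool) n' (dm' : bool) (h' : 'I_K -> int) :
  put wf (word (nseq fl true)) 0%R = word (nseq fl' true) ->
  (forall i, put wi (word (nseq n true)) (h i) = word (nseq n' true)) ->
  (forall i j, put wd (word (nseq dm true)) (h i - h j)%R = word (nseq dm' true)) ->
  (forall i, h' i = shift (mx i) (h i)) ->
  (forall i j, shift (md i j) (h i - h j)%R = (h' i - h' j)%R) ->
  let s := layout W p f q fl n dm h in
  perform (tape_action mi wo mo wf wi wd mx md (scan s)) s =
  layout W (shift mi p) (put wo f q) (shift mo q) fl' n' dm' h'.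
Proof.
move=> ef en ed eh ehh s; apply: functional_extensionality.
rewrite /perform /tape_action /scan => -[[[[i|[i j]]|]|]|] /=.
- by rewrite perform_put en eh.
- by rewrite perform_put ed ehh.
- by rewrite perform_put ef.
- by rewrite perform_put.
- congr pair; apply: functional_extensionality => z; by case: eqP => [->|].
Qed.

Lemma runs_tape_action W p f q (fl : bool) n (dm : bool) (h : 'I_K -> int) mi wo mo wf
    wi wd mx md p' f' q' (fl' : bool) n' (dm' : bool) (h' : 'I_K -> int) :
  p' = shift mi p -> f' = put wo f q -> q' = shift mo q ->
  put wf (word (nseq fl true)) 0%R = word (nseq fl' true) ->
  (forall i, put wi (word (nseq n true)) (h i) = word (nseq n' true)) ->
  (forall i j, put wd (word (nseq dm true)) (h i - h j)%R = word (nseq dm' true)) ->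
  (forall i, h' i = shift (mx i) (h i)) ->
  (forall i j, shift (md i j) (h i - h j)%R = (h' i - h' j)%R) ->
  runs (Act (tape_action mi wo mo wf wi wd mx md)) (layout W p f q fl n dm h)
    (layout W p' f' q' fl' n' dm' h') 1.
Proof.
by move=> -> -> -> ef en ed eh ehh; apply: runs_act; apply: perform_tape_action.
Qed.

Definition stay1 (i : 'I_K) := Stay.
Definition stay2 (i j : 'I_K) := Stay.

Definition slide (mi mo : move) : program tape_name :=
  Act (tape_action mi None mo None None None stay1 stay2).

Lemma runs_slide W p f q fl n dm h mi mo :
  runs (slide mi mo) (layout W p f q fl n dm h)
    (layout W (shift mi p) f (shift mo q) fl n dm h) 1.
Proof. by apply: runs_act; apply: perform_tape_action. Qed.

Definition way (up : bool) := if up then MoveRight else MoveLeft.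

(** The offset of [(i, l)] is unchanged if both or neither of the indices is [j]; it follows the
    counter if only [i] is, and moves against it if only [l] is. *)
Definition bump (up : bool) (j : 'I_K) : program tape_name :=
  Act (tape_action Stay None Stay None None None
    (fun i => if i == j then way up else Stay)
    (fun i l => if (i == j) == (l == j) then Stay
                else way (if i == j then up else ~~ up))).

Lemma runs_bump W p f q fl n dm h up j :
  runs (bump up j) (layout W p f q fl n dm h)
    (layout W p f q fl n dm (fun i => if i == j then shift (way up) (h i) else h i)) 1.
Proof.
apply: runs_act; apply: perform_tape_action => // [i|i l]; first by case: eqP.
by case: (i == j); case: (l == j); case: up; rewrite /=; lia.
Qed.

Definition nonblank (x : tape_name) (y : tape_name -> symb) : bool := y x != None.

Section Loops.

Variables (W : seq bool) (n : nat).

Definition data : Type := (int * (int -> symb) * int * bool)%type.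

(* The first counters hold the prefix pre of the current tuple, the others 0. *)
Definition loop_state (d : data) (pre : seq nat) : tapes tape_name :=
  layout W d.1.1.1 d.1.1.2 d.1.2 d.2 n true (fun i => Posz (nth 0 pre i)).

(** The marks on cells [0] to [n - 1] delimit the loop: the head leaves them at cell [n], steps
    back, runs left to the blank cell [-1], and returns to [0]. *)
Definition for_ (j : 'I_K) (body : program tape_name) : program tape_name :=
  Seq (While (nonblank (counter j)) (Seq body (bump true j)))
    (Seq (bump false j)
       (Seq (While (nonblank (counter j)) (bump false j)) (bump true j))).

(** Inside a loop the counter [j] may stand at [-1], which [loop_state] cannot express. *)
Let stz (d : data) (pre : seq nat) (j : 'I_K) (z : int) : tapes tape_name :=
  layout W d.1.1.1 d.1.1.2 d.1.2 d.2 n true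
    (fun i => if i == j then z else Posz (nth 0 pre i)).

Let stzE d pre (j : 'I_K) (i : nat) : size pre = j ->
  stz d pre j i = loop_state d (rcons pre i).
Proof.
move=> jE; rewrite /loop_state /stz; congr layout; apply: functional_extensionality => x.
rewrite nth_rcons jE -val_eqE /=; case: ltngtP => // jx.
by rewrite nth_default // jE ltnW.
Qed.

Let stz0 d pre (j : 'I_K) : size pre = j -> stz d pre j 0 = loop_state d pre.
Proof.
move=> jE; rewrite stzE // /loop_state; congr layout; apply: functional_extensionality => x.
by rewrite nth_rcons; case: ltngtP => // h; rewrite nth_default // -?h // ltnW.
Qed.

Let bumpE d pre up j z z' : shift (way up) z = z' ->
  runs (bump up j) (stz d pre j z) (stz d pre j z') 1.
Proof.
move=> <-; have := runs_bump W d.1.1.1 d.1.1.2 d.1.2 d.2 n true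
  (fun i => if i == j then z else Posz (nth 0 pre i)) up j.
congr runs; rewrite /stz; congr layout; apply: functional_extensionality => i.
by case: eqP.
Qed.

Let nonblankE d pre (j : 'I_K) z :
  nonblank (counter j) (scan (stz d pre j z)) = (0 <= z < n)%R.
Proof.
rewrite /nonblank /scan /= eqxx; case: z => k //.
by rewrite word_nth size_nseq lez_nat ltz_nat /=; case: ltnP.
Qed.

Lemma runs_for (body : program tape_name) (d : nat -> data) pre (j : 'I_K) t :
  size pre = j ->
  (forall i, i < n ->
     runs body (loop_state (d i) (rcons pre i)) (loop_state (d i.+1) (rcons pre i)) t) ->
  runs (for_ j body) (loop_state (d 0) pre) (loop_state (d n) pre) (n.+1 * (t + 4)).
Proof.
move=> jE hb; rewrite -!(stz0 _ jE).
have h1 := @runs_while _ (nonblank (counter j)) (Seq body (bump true j))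
  (fun i => stz (d i) pre j i) n (t + 1).
have h2 : runs (bump false j) (stz (d n) pre j n) (stz (d n) pre j (n%:Z - 1%:Z)%R) 1.
  exact: bumpE.
have h3 := @runs_while _ (nonblank (counter j)) (bump false j)
  (fun i => stz (d n) pre j (n%:Z - i.+1%:Z)%R) n 1.
have h4 : runs (bump true j) (stz (d n) pre j (n%:Z - n.+1%:Z)%R)
   (stz (d n) pre j 0%R) 1.
  by apply: bumpE => /=; lia.
apply: (runs_leq _ (runs_seq (h1 _ _ _) (runs_seq h2 (runs_seq (h3 _ _ _) h4)))).
- by rewrite mulSn -[(t + 1).+1]addn1 !mulnDr; lia.
- by move=> i ni; rewrite nonblankE; lia.
- by rewrite nonblankE; lia.
- move=> i ni; apply: (runs_seq (s2 := stz (d i.+1) pre j i)).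
    by rewrite !stzE //; apply: hb.
  by apply: bumpE => /=; lia.
- by move=> i ni; rewrite nonblankE; lia.
- by rewrite nonblankE; lia.
- by move=> i ni; apply: bumpE => /=; lia.
Qed.

Fixpoint loops (j k : nat) (body : program tape_name) : program tape_name :=
  if k is k'.+1 then for_ (inord j) (loops j.+1 k' body) else body.

(** Each level multiplies the time by at most [5 * n.+1], since [t + 4 <= 5 * t] for [t > 0]. *)
Lemma runs_loops_at (body : program tape_name) (F : seq nat -> data -> data) k pre d :
  (forall l d, size l = size pre + k -> runs body (loop_state d l) (loop_state (F l d) l) 1) ->
  size pre + k < K ->
  runs (loops (size pre) k body) (loop_state d pre)
    (loop_state (foldl (fun d l => F (pre ++ l) d) d (lex_seqs n k)) pre) ((5 * n.+1) ^ k).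
Proof.
elim: k pre d => [|k IHk] pre d hb kK.
  by rewrite /= cats0; apply: hb; rewrite addn0.
(* [step i] is the effect of one round of the outermost loop, and [D i] the data after [i]
   rounds. *)
pose step i d := foldl (fun d l => F (rcons pre i ++ l) d) d (lex_seqs n k).
pose D i := foldl (fun d i => step i d) d (iota 0 i).
have -> : foldl (fun d l => F (pre ++ l) d) d (lex_seqs n k.+1) = D n.
  rewrite /D /=; elim: (iota 0 n) d {D} => //= x s IHs d.
  rewrite foldl_cat IHs; congr foldl; rewrite /step.
  elim: (lex_seqs n k) d => //= l ls IHl d; by rewrite cat_rcons IHl.
have jK : (inord (size pre) : 'I_K) = size pre :> nat.
  by rewrite inordK //; move: kK; rewrite /width; lia.
have h := @runs_for (loops (size pre).+1 k body) D pre (inord (size pre))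
  ((5 * n.+1) ^ k) (esym jK).
apply: (runs_leq _ (h _)).
  rewrite expnS; have : 0 < (5 * n.+1) ^ k by rewrite expn_gt0.
  by move: ((5 * n.+1) ^ k) => t t0; rewrite mulnAC mulnC leq_mul2r; lia.
move=> i ni; have -> : D i.+1 = step i (D i).
  by rewrite /D -addn1 iotaD foldl_cat.
have := IHk (rcons pre i) (D i); rewrite size_rcons; apply.
  by move=> l d' hl; apply: hb; rewrite hl; lia.
by lia.
Qed.

(** A common bound for the loops of all arities, polynomial in [n] because [K] depends on the
    signature only. *)
Definition budget : nat := (5 * n.+1) ^ K.

Lemma runs_loops (body : program tape_name) (F : seq nat -> data -> data) k d :
  (forall l d, size l = k -> runs body (loop_state d l) (loop_state (F l d) l) 1) -> k < K ->
  runs (loops 0 k body) (loop_state d [::])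
    (loop_state (foldl (fun d l => F l d) d (lex_seqs n k)) [::]) budget.
Proof.
move=> hb kK; apply: (runs_leq _ (@runs_loops_at body F k [::] d hb kK)).
by apply: leq_pexp2l; [rewrite muln_gt0 | exact: ltnW].
Qed.

End Loops.

End Tapes.

(** * Passes over the tuples of a single symbol *)

Section Passes.

Variable tau : signature.
Notation K := (width tau).
Notation tape_name := (tape_name tau).
Notation pattern := (pattern tau).
Notation input := (None : tape_name).
Notation output := (Some None : tape_name).
Notation offset ij := (Some (Some (Some (inr ij))) : tape_name).

Definition reads_true (a : symb) : bool := a == Some (inl true).

(** Counters from [k] on rest at 0, so the marks on their offset tapes say nothing; positions beyond
    the end are settled as in [eqpat]. *)
Definition scanned_pattern (k : nat) (y : tape_name -> symb) : pattern :=
  [ffun ij : 'I_K * 'I_K => if (ij.1 < k) && (ij.2 < k) then reads_true (y (offset ij))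
             else (k <= ij.1) && (k <= ij.2)].

(* One step of a pass over the tuples of size k: the output bit is computed
   from the pattern of the tuple, the input bit, and the old output bit. *)
Definition emit (k : nat) (G : pattern -> bool -> bool -> bool)
    (D : pattern -> bool -> bool) : program tape_name :=
  Act (fun y =>
    let E := scanned_pattern k y in
    let b := reads_true (y input) in
    tape_action MoveRight (Some (Some (inl (G E b (reads_true (y output)))))) MoveRight
      (if D E b then Some (Some (inl true)) else None) None None
      (@stay1 tau) (@stay2 tau) y).

Section Run.

Variables (W : seq bool) (n : nat).

Notation loop_state := (@loop_state tau W n).

Definition emit_data (G : pattern -> bool -> bool -> bool)
    (D : pattern -> bool -> bool) (l : seq nat) (d : data) : data :=
  let: (p, f, q, fl) := d in
  let b := reads_true (word W p) in
  ((p + 1)%R,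
   put (Some (Some (inl (G (eqpat tau l) b (reads_true (f q)))))) f q, (q + 1)%R,
   fl || D (eqpat tau l) b).

Definition slide_data (mi mo : move) (l : seq nat) (d : data) : data :=
  let: (p, f, q, fl) := d in (shift mi p, f, shift mo q, fl).

Lemma scanned_patternE (k : nat) (d : data) (l : seq nat) : size l = k ->
  scanned_pattern k (scan (loop_state d l)) = eqpat tau l.
Proof.
move=> lk; apply/ffunP => -[i j]; rewrite !ffunE /= -lk.
case: ltnP => il; last first.
  rewrite (onth_default il) /=; case: ltnP => jl; last by rewrite onth_default.
  by rewrite onthE (nth_map 0).
rewrite (onthE l i) (nth_map 0) //; case: ltnP => jl; last by rewrite onth_default.
rewrite onthE (nth_map 0) // /reads_true /scan /=.
have -> : (Some (nth 0 l i) == Some (nth 0 l j)) = (nth 0 l i == nth 0 l j) by [].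
case: (ltngtP (nth 0 l i) (nth 0 l j)) => h.
- by case e: (_ - _)%R => [z|z] //; lia.
- by case e: (_ - _)%R => [[|z]|z] //; [lia|rewrite word_nth].
- by rewrite h GRing.subrr.
Qed.

Lemma runs_emit k G D (d : data) (l : seq nat) : size l = k ->
  runs (emit k G D) (loop_state d l) (loop_state (emit_data G D l d) l) 1.
Proof.
move=> lk; apply: runs_act; rewrite (scanned_patternE d lk).
case: d => [[[p f] q] fl]; rewrite /loop_state /=.
apply: perform_tape_action => //; rewrite [scan _ _]/=.
apply: functional_extensionality => z.
by case: (D _ _); case: fl => //; case: z => [[|[|z]]|z].
Qed.

Lemma runs_slide_loop mi mo (d : data) (l : seq nat) :
  runs (slide tau mi mo) (loop_state d l) (loop_state (slide_data mi mo l d) l) 1.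
Proof. by case: d => [[[p f] q] fl]; apply: runs_slide. Qed.

Definition rest_state (p : nat) (u : seq bool) (q : nat) (fl : bool) : tapes tape_name :=
  loop_state (Posz p, word u, Posz q, fl) [::].

Section OneSymbol.

Variable k : nat.
Hypothesis kK : k < K.
Variables (X : Type) (phi : X -> seq nat) (xs : seq X).
Hypothesis xsE : map phi xs = lex_seqs n k.

Let N := size xs.

Lemma foldl_slide mi mo (ys : seq X) p f q fl :
  foldl (fun d l => slide_data mi mo l d) (p, f, q, fl) (map phi ys) =
  (iter (size ys) (shift mi) p, f, iter (size ys) (shift mo) q, fl).
Proof. by elim: ys p q => //= y ys IHs p q; rewrite IHs -!iterSr. Qed.

Lemma iter_right m (p : nat) : iter m (shift MoveRight) p = Posz (p + m).
Proof. by elim: m => [|m IHm] /=; [rewrite addn0|rewrite IHm; lia]. Qed.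

Lemma iter_left m (p : nat) : iter m (shift MoveLeft) (Posz (p + m)) = p.
Proof. 
have h z : iter m (shift MoveLeft) z = (z - m%:Z)%R.
  by elim: m => [|m IHm] /=; [lia|rewrite IHm; lia].
by rewrite h; lia.
Qed.

Lemma iter_stay m (p : nat) : iter m (shift Stay) p = p.
Proof. by elim: m. Qed.

Definition loop_slide mi mo := loops 0 k (slide tau mi mo).

Lemma runs_loop_slide mi mo p u q fl p' q' :
  iter N (shift mi) (Posz p) = Posz p' -> iter N (shift mo) (Posz q) = Posz q' ->
  runs (loop_slide mi mo) (rest_state p u q fl) (rest_state p' u q' fl) (budget tau n).
Proof.
move=> pE qE.
have := runs_loops (W := W) (F := slide_data mi mo) (Posz p, word u, Posz q, fl)
  (fun l d _ => runs_slide_loop mi mo d l) kK.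
by rewrite -xsE foldl_slide pE qE.
Qed.

(** The flag [c] tells whether the pass overwrites an earlier vector [b] or appends to the
    output. *)
Lemma foldl_emit G D (a b : X -> bool) (c : bool) (ys : seq X) p u fl rest :
  drop p W = map a ys ++ rest ->
  foldl (fun d l => emit_data G D l d)
    (Posz p, word (u ++ if c then map b ys else [::]), Posz (size u), fl)
    (map phi ys) =
  (Posz (p + size ys),
   word (u ++ [seq G (eqpat tau (phi y)) (a y) (c && b y) | y <- ys]),
   Posz (size u + size ys), fl || has (fun y => D (eqpat tau (phi y)) (a y)) ys).
Proof.
elim: ys p u fl => [|y ys IHs] p u fl h /=; first by rewrite if_same !addn0 orbF.
have hb : reads_true (word W p) = a y.
  by rewrite /reads_true word_true -[p]addn0 -nth_drop h.
have ho : reads_true (word (u ++ if c then b y :: map b ys else [::]) (size u)) =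
    c && b y.
  rewrite /reads_true word_true nth_cat ltnn subnn; by case: (c).
have h' : drop p.+1 W = map a ys ++ rest.
  by rewrite -add1n -drop_drop h /= drop0.
rewrite hb ho put_word.
have -> : behead (if c then b y :: map b ys else [::]) = if c then map b ys else [::].
  by case: (c).
rewrite -cat_rcons -[(Posz p + 1)%R]/(Posz (p + 1)) -[(Posz _ + 1)%R]/(Posz (size u + 1)).
have := IHs _ (rcons u (G (eqpat tau (phi y)) (a y) (c && b y)))
  (fl || D (eqpat tau (phi y)) (a y)) h'.
by rewrite size_rcons !addn1 => ->; rewrite cat_rcons !addSnnS orbA.
Qed.

Lemma runs_emits G D (a b : X -> bool) (c : bool) p u fl rest :
  drop p W = map a xs ++ rest ->
  runs (loops 0 k (emit k G D))
    (rest_state p (u ++ if c then map b xs else [::]) (size u) fl)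
    (rest_state (p + N) (u ++ [seq G (eqpat tau (phi x)) (a x) (c && b x) | x <- xs])
       (size u + N) (fl || has (fun x => D (eqpat tau (phi x)) (a x)) xs))
    (budget tau n).
Proof.
move=> h; have := runs_loops (W := W) (F := emit_data G D)
  (Posz p, word (u ++ if c then map b xs else [::]), Posz (size u), fl)
  (fun l d => @runs_emit k G D d l) kK.
by rewrite -xsE (foldl_emit G D b c u fl h).
Qed.

(* Reread the characteristic vector of R once for each pattern. *)
Definition split_symbol : program tape_name :=
  Seq (seqs [seq Seq (loops 0 k (emit k (fun E' b _ => b && (E' == E)) (fun _ _ => false)))
                   (loop_slide MoveLeft Stay) | E <- enum pattern])
    (loop_slide MoveRight Stay).

Lemma runs_split_symbol (a : X -> bool) p u fl rest :
  drop p W = map a xs ++ rest ->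
  let u' := u ++ flatten [seq [seq a x && (eqpat tau (phi x) == E) | x <- xs]
                         | E <- enum pattern] in
  runs split_symbol (rest_state p u (size u) fl) (rest_state (p + N) u' (size u') fl)
    ((#|pattern| * 2 + 2) * budget tau n).
Proof.
move=> h /=; have b0 : 0 < budget tau n by rewrite expn_gt0.
(* Two loops per pattern and one final slide; a spare [budget] absorbs the step of the empty
   sequence. *)
rewrite mulnDl; apply: (runs_leq (m := #|pattern| * 2 * budget tau n + 1 + budget tau n)).
  by move: (budget tau n) b0 => B B0; rewrite -addnA leq_add2l mul2n -addnn leq_add2r.
apply: runs_seq; last by apply: runs_loop_slide; rewrite ?iter_right ?iter_stay.
rewrite cardE; elim: (enum pattern) u => [|E Es IHs] u /=.
  by rewrite cats0; apply: runs_nil.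
rewrite mulSn mulnDl -addnA; apply: runs_seq; last first.
  by rewrite catA; apply: IHs.
rewrite mul2n -addnn; apply: runs_seq; last first.
  apply: runs_loop_slide; first exact: iter_left.
  by rewrite iter_stay.
have := runs_emits (fun E' b _ => b && (E' == E)) (fun _ _ => false) a false u fl h.
by rewrite cats0 (eq_has (a2 := pred0)) // has_pred0 orbF size_cat size_map.
Qed.

(* The vector of R is the disjunction, accumulated on the output tape, of the
   vectors of the R_E restricted to the tuples of pattern E. *)
Definition merge_symbol : program tape_name :=
  Seq (loops 0 k (emit k (fun _ _ _ => false) (fun _ _ => false)))
  (Seq (loop_slide MoveLeft MoveLeft)
  (Seq (seqs [seq Seq (loops 0 k (emit k (fun E' b o => o || (b && (E' == E)))
                         (fun E' b => b && [exists ij, E' ij && ~~ E ij])))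
                    (loop_slide Stay MoveLeft) | E <- enum pattern])
    (loop_slide Stay MoveRight))).

Lemma runs_merge_symbol (a : pattern -> X -> bool) p u fl rest :
  drop p W = flatten [seq map (a E) xs | E <- enum pattern] ++ rest ->
  let u' := u ++ [seq a (eqpat tau (phi x)) x | x <- xs] in
  runs merge_symbol (rest_state p u (size u) fl)
    (rest_state (p + #|pattern| * N) u' (size u')
       (fl || has (fun E => has (fun x => a E x && collapsed E (phi x)) xs)
                (enum pattern)))
    ((#|pattern| * 2 + 4) * budget tau n).
Proof.
move=> h /=; have b0 : 0 < budget tau n by rewrite expn_gt0.
apply: (runs_leq (m := budget tau n + (budget tau n +
  (#|pattern| * 2 * budget tau n + 1 + budget tau n)))).
  by move: (budget tau n) b0 => B B0; rewrite mulnDl; move: (_ * 2 * B) => m; lia.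
(* The first pass writes zeros while its input head crosses the vector of some first pattern
   [E0]. *)
have [E0 [Es0 EsE]] : exists E0 Es0, enum pattern = E0 :: Es0.
  case e: (enum pattern) => [|E0 Es0]; last by exists E0, Es0.
  by have := mem_enum pattern [ffun=> false]; rewrite e.
have [rest0 h0] : exists rest0, drop p W = map (a E0) xs ++ rest0.
  by rewrite h EsE /= -catA; eexists.
(* The zero vector is made a variable, so that the induction on patterns can replace it by partial
   disjunctions. *)
have [v0 v0E] : exists v0 : X -> bool, v0 =1 xpred0 by exists xpred0.
have h1 := runs_emits (fun _ _ _ => false) (fun _ _ => false) v0 false u fl h0.
apply: (runs_seq (s2 := rest_state (p + N) (u ++ map v0 xs) (size u + N) fl)).
  rewrite (eq_map v0E).
  by move: h1; rewrite cats0 (eq_has (a2 := pred0)) // has_pred0 orbF.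
apply: (runs_seq (s2 := rest_state p (u ++ map v0 xs) (size u) fl)).
  by apply: runs_loop_slide; apply: iter_left.
rewrite size_cat size_map.
apply: runs_seq; last by apply: runs_loop_slide; rewrite ?iter_right ?iter_stay.
have -> : [seq a (eqpat tau (phi x)) x | x <- xs] =
  [seq v0 x || has (fun E => a E x && (eqpat tau (phi x) == E)) (enum pattern)
  | x <- xs].
  apply: eq_map => x /=; rewrite v0E; apply/idP/hasP => [ax|[E _ /andP[ax /eqP->]]] //.
  by exists (eqpat tau (phi x)); rewrite ?mem_enum ?ax ?eqxx.
move: h; rewrite cardE; clear h0 h1 EsE v0E.
elim: (enum pattern) v0 p fl => [|E Es IHs] v p fl /= h.
  rewrite addn0 orbF;have -> : [seq v x || false | x <- xs] = map v xs.
    by apply: eq_map => x; rewrite orbF.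
  exact: runs_nil.
move: h; rewrite -catA => h.
rewrite [_.+1 * 2]mulSn mulnDl -addnA [_.+1 * N]mulSn (addnA p); apply: runs_seq; last first.
  have -> : [seq v x || (a E x && (eqpat tau (phi x) == E)
       || has (fun E => a E x && (eqpat tau (phi x) == E)) Es) | x <- xs] =
     [seq (v x || (a E x && (eqpat tau (phi x) == E))) ||
        has (fun E => a E x && (eqpat tau (phi x) == E)) Es | x <- xs].
    by apply: eq_map => x; rewrite orbA.
  rewrite orbA; apply: IHs.
  by rewrite addnC -drop_drop h drop_size_cat ?size_map.
rewrite mul2n -addnn; apply: runs_seq; last first.
  apply: runs_loop_slide; last exact: iter_left.
  by rewrite iter_stay.
have := runs_emits (fun E' b o => o || (b && (E' == E)))
  (fun E' b => b && [exists ij, E' ij && ~~ E ij]) v true u fl h.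
exact.
Qed.

End OneSymbol.

End Run.

End Passes.

(** * Prologue, epilogue, and passes over all symbols *)

Section Whole.

Variable tau : signature.
Notation K := (width tau).
Notation tape_name := (tape_name tau).
Notation pattern := (pattern tau).
Notation input := (None : tape_name).
Notation output := (Some None : tape_name).
Notation flag := (Some (Some None) : tape_name).
Notation rest_state := (@rest_state tau).
Notation layout := (@layout tau).
Notation counter i := (Some (Some (Some (inl i))) : tape_name).

Definition copy_mark : program tape_name :=
  Act (tape_action MoveRight (Some (Some (inl true))) MoveRight None
         (Some (Some (inl true))) None (fun=> MoveRight) (@stay2 tau)).

Definition copy_separator : program tape_name :=
  Act (tape_action MoveRight (Some (Some (inl false))) MoveRight None None
         (Some (Some (inl true))) (fun=> MoveLeft) (@stay2 tau)).

Definition move_counters (m : move) : program tape_name :=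
  Act (tape_action Stay None Stay None None None (fun=> m) (@stay2 tau)).

(** All counters move together, so every offset head stays on cell 0, where [copy_separator] leaves
    the mark. That action also moves the counters from cell [n] back to the last mark, from where
    they rewind past cell 0 and return. *)
Definition prologue : program tape_name :=
  Seq (While (fun y => reads_true (y input)) copy_mark)
  (Seq copy_separator
  (Seq (While (nonblank (counter ord0)) (move_counters MoveLeft))
    (move_counters MoveRight))).

Lemma runs_prologue (n : nat) (I : seq bool) :
  let W := nseq n true ++ false :: I in
  runs prologue (layout W 0 (word [::]) 0 false 0 false (fun=> 0%R))
    (rest_state W n n.+1 (nseq n true ++ [:: false]) n.+1 false) (5 * n.+1).
Proof.
(* [s1 i] is the state after copying [i] marks; in [s2 i] the counters stand at [n - i], so
   rewinding goes from [s2 1] to [s2 n.+1], and the last move returns to [s2 n]. *)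
move=> W; pose s1 (i : nat) := layout W i (word (nseq i true)) i false i false (fun=> Posz i).
pose s2 (i : nat) := layout W n.+1 (word (nseq n true ++ [:: false])) n.+1 false n true
  (fun=> (n%:Z - i%:Z)%R).
have -> : rest_state W n n.+1 (nseq n true ++ [:: false]) n.+1 false = s2 n.
  rewrite /rest_state /loop_state /s2; congr layout; apply: functional_extensionality => i.
  by rewrite nth_nil GRing.subrr.
apply: (runs_leq (m := (n * 2).+1 + (1 + ((n * 2).+1 + 1)))); first by lia.
apply: runs_seq.
  apply: (runs_while (f := s1)) => [i ni||i ni].
  - by rewrite /reads_true /scan word_true nth_cat size_nseq ni nth_nseq ni.
  - by rewrite /reads_true /scan word_true nth_cat size_nseq ltnn subnn.
  - have hw : put (Some (Some (inl true))) (word (nseq i true)) i = word (nseq i.+1 true).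
      rewrite -{2}[i](size_nseq i true) put_word_end; congr word_tape.
      by elim: (i) => //= k ->.
    by apply: runs_tape_action => //= *; rewrite ?hw //; lia.
apply: (runs_seq (s2 := s2 1)).
  apply: runs_tape_action => //=; try (move=> *; lia).
    by rewrite -{3}[n](size_nseq n true) put_word_end cats1.
  move=> _ _; rewrite GRing.subrr; apply: functional_extensionality => z.
  by case: z => [[|[|z]]|z].
apply: runs_seq.
  apply: (runs_while (f := fun i => s2 i.+1)) => [i ni||i ni].
  - rewrite /nonblank /scan /s2 /=; have -> : (n%:Z - i.+1%:Z)%R = Posz (n - i.+1) by lia.
    by rewrite word_nth size_nseq; case: ltnP => //; lia.
  - by rewrite /nonblank /scan /s2 /=; have -> : (n%:Z - n.+1%:Z)%R = Negz 0 by lia.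
  - by apply: runs_tape_action => //= *; lia.
by apply: runs_tape_action => //= *; lia.
Qed.

Definition clear_flag : program tape_name :=
  Act (tape_action Stay None MoveLeft (Some None) None None (@stay1 tau) (@stay2 tau)).

Definition erase_bit : program tape_name :=
  Act (tape_action Stay (Some None) MoveLeft None None None (@stay1 tau) (@stay2 tau)).

Definition write_bit (b : bool) : program tape_name :=
  Act (tape_action Stay (Some (Some (inl b))) MoveRight None None None
         (@stay1 tau) (@stay2 tau)).

(* A raised flag means that a collapsed tuple was met: the output is then
   replaced by the encoding c of a fixed NO instance. *)
Definition epilogue (c : seq bool) : program tape_name :=
  While (fun y => reads_true (y flag))
    (Seq clear_flag
    (Seq (While (nonblank output) erase_bit)
    (Seq (slide tau Stay MoveRight) (seqs [seq write_bit b | b <- c])))).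

Lemma runs_write_bits W n p u c fl :
  runs (seqs [seq write_bit b | b <- c]) (rest_state W n p u (size u) fl)
    (rest_state W n p (u ++ c) (size (u ++ c)) fl) (size c).+1.
Proof.
elim: c u => [|b c IHc] u /=; first by rewrite cats0; apply: runs_nil.
rewrite -add1n; apply: runs_seq; last by rewrite -cat_rcons; apply: IHc.
apply: runs_tape_action => //=; last by rewrite size_rcons; lia.
by rewrite put_word_end.
Qed.

(** The outer [While] acts as a conditional: [clear_flag] makes its test fail after one round. *)
Lemma runs_epilogue W n p u c (fl : bool) :
  let u' := if fl then c else u in
  runs (epilogue c) (rest_state W n p u (size u) fl)
    (rest_state W n p u' (size u') false) (2 * size u + size c + 6).
Proof.
case: fl => /=; last first.
  have h := @runs_while _ (fun y : tape_name -> symb => reads_true (y flag))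
    (Seq clear_flag (Seq (While (nonblank output) erase_bit)
      (Seq (slide tau Stay MoveRight) (seqs [seq write_bit b | b <- c]))))
    (fun=> rest_state W n p u (size u) false) 0 0.
  by apply: (runs_leq _ (h _ _ _)) => //; lia.
(* After [i] erasures the output head is on the last remaining bit, hence the [- 1]; it ends at
   [-1], and the slide brings it to 0. *)
pose s2 (i : nat) := layout W p (word (take (size u - i) u)) ((size u)%:Z - i%:Z - 1)%R false n true
  (fun i => Posz (nth 0 [::] i)).
have h := @runs_while _ (fun y : tape_name -> symb => reads_true (y flag))
  (Seq clear_flag (Seq (While (nonblank output) erase_bit)
    (Seq (slide tau Stay MoveRight) (seqs [seq write_bit b | b <- c]))))
  (fun i => if i is 0 then rest_state W n p u (size u) true
            else rest_state W n p c (size c) false) 1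
  (1 + ((size u * 2).+1 + (1 + (size c).+1))).
apply: (runs_leq _ (h _ _ _)) => //; [lia|by case|case=> // _].
apply: (runs_seq (s2 := s2 0)).
  rewrite /s2 subn0 take_size; apply: runs_tape_action => //=.
  + lia.
  + by move=> *; apply: functional_extensionality => -[[|[|z]]|z].
apply: (runs_seq (s2 := s2 (size u))).
  apply: (runs_while (f := s2)) => [i iu||i iu].
  - rewrite /nonblank /scan /s2 /=.
    have -> : ((size u)%:Z - i%:Z - 1)%R = Posz (size u - i.+1) by lia.
    rewrite word_nth size_take; case: ltnP => //.
    by case: ltnP; lia.
  - rewrite /nonblank /scan /s2 /=.
    by have -> : ((size u)%:Z - (size u)%:Z - 1)%R = Negz 0 by lia.
  - have iE : size u - i = (size u - i.+1).+1 by lia.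
    rewrite /s2.
    have -> : word (take (size u - i.+1) u) =
        put (Some None) (word (take (size u - i) u)) ((size u)%:Z - i%:Z - 1)%R.
      rewrite iE (take_nth false) ?ltn_subrL; last by lia.
      have <- : Posz (size (take (size u - i.+1) u)) = ((size u)%:Z - i%:Z - 1)%R.
        by rewrite size_takel; lia.
      by rewrite put_blank.
    by apply: runs_tape_action => //=; lia.
have hw := runs_write_bits W n p [::] c false.
apply: (runs_seq _ hw).
have := runs_slide W p (word [::]) (-1)%R false n true
  (fun i : 'I_K => Posz (nth 0 [::] i)) Stay MoveRight.
congr runs; rewrite /s2 subnn take0; congr layout; lia.
Qed.

Section Symbols.

Variables (W : seq bool) (n : nat).

Lemma runs_split (a : forall R : sym tau, (arity R).-tuple 'I_n -> bool)
    (Rs : seq (sym tau)) p u fl :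
  drop p W = flatten [seq [seq a R t | t <- lex_tuples n (arity R)] | R <- Rs] ->
  let u' := u ++ flatten [seq flatten [seq
    [seq a R t && (eqpat tau t == E) | t <- lex_tuples n (arity R)]
    | E <- enum pattern] | R <- Rs] in
  exists p', runs (seqs [seq split_symbol tau (arity R) | R <- Rs])
    (rest_state W n p u (size u) fl) (rest_state W n p' u' (size u') fl)
    (size Rs * ((#|pattern| * 2 + 2) * budget tau n) + 1).
Proof.
elim: Rs p u => [|R Rs IHs] p u /= h.
  by exists p; rewrite cats0; apply: runs_nil.
have h1 := runs_split_symbol (arity_width R) (lex_seqs_tuples n (arity R)) u fl h.
have e E : [seq a R t && (eqpat tau [seq val x | x <- tval t] == E)
   | t <- lex_tuples n (arity R)] =
   [seq a R t && (eqpat tau t == E) | t <- lex_tuples n (arity R)].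
  by apply: eq_map => t; rewrite eqpat_map_in // => x y _ _; apply: val_inj.
have {e} e : [seq [seq a R t && (eqpat tau [seq val x | x <- tval t] == E)
   | t <- lex_tuples n (arity R)] | E <- enum pattern] =
   [seq [seq a R t && (eqpat tau t == E) | t <- lex_tuples n (arity R)]
   | E <- enum pattern] by apply: eq_map => E; apply: e.
rewrite e in h1.
have [|p' hp'] := IHs (p + size (lex_tuples n (arity R)))
  (u ++ flatten [seq [seq a R t && (eqpat tau t == E)
     | t <- lex_tuples n (arity R)] | E <- enum pattern]).
  by rewrite addnC -drop_drop h drop_size_cat ?size_map.
by exists p'; rewrite catA mulSn -addnA; apply: runs_seq hp'.
Qed.

Lemma runs_merge (a : forall (R : sym tau) (E : pattern), (arity R).-tuple 'I_n -> bool)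
    (Rs : seq (sym tau)) p u fl :
  drop p W = flatten [seq flatten [seq [seq a R E t | t <- lex_tuples n (arity R)]
    | E <- enum pattern] | R <- Rs] ->
  let u' := u ++ flatten [seq
    [seq a R (eqpat tau t) t | t : (arity R).-tuple 'I_n <- lex_tuples n (arity R)] | R <- Rs] in
  exists p', runs (seqs [seq merge_symbol tau (arity R) | R <- Rs])
    (rest_state W n p u (size u) fl)
    (rest_state W n p' u' (size u')
      (fl || has (fun R => has (fun E => has (fun t => a R E t && collapsed E t)
        (lex_tuples n (arity R))) (enum pattern)) Rs))
    (size Rs * ((#|pattern| * 2 + 4) * budget tau n) + 1).
Proof.
elim: Rs p u fl => [|R Rs IHs] p u fl /= h.
  by exists p; rewrite cats0 orbF; apply: runs_nil.
have h1 := runs_merge_symbol (arity_width R) (lex_seqs_tuples n (arity R)) u fl h.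
have ev (t : (arity R).-tuple 'I_n) : eqpat tau [seq val x | x <- tval t] = eqpat tau t.
  by rewrite eqpat_map_in // => x y _ _; apply: val_inj.
have e1 : [seq a R (eqpat tau [seq val x | x <- tval t]) t | t <- lex_tuples n (arity R)] =
   [seq a R (eqpat tau t) t | t : (arity R).-tuple 'I_n <- lex_tuples n (arity R)].
  by apply: eq_map => t; rewrite ev.
have e2 : has (fun E => has (fun t => a R E t && collapsed E [seq val x | x <- tval t])
      (lex_tuples n (arity R))) (enum pattern) =
   has (fun E => has (fun t => a R E t && collapsed E t)
        (lex_tuples n (arity R))) (enum pattern).
  by apply: eq_has => E; apply: eq_has => t; rewrite /collapsed ev.
rewrite e1 e2 in h1.
have [|p' hp'] := IHs (p + #|pattern| * size (lex_tuples n (arity R)))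
  (u ++ [seq a R (eqpat tau t) t | t : (arity R).-tuple 'I_n <- lex_tuples n (arity R)])
  (fl || has (fun E => has (fun t => a R E t && collapsed E t)
        (lex_tuples n (arity R))) (enum pattern)).
  rewrite addnC -drop_drop h drop_size_cat // cardE size_flatten /shape -map_comp.
  elim: (enum pattern) => //= E Es ->; by rewrite size_map mulSn.
by exists p'; rewrite catA orbA mulSn -addnA; apply: runs_seq hp'.
Qed.

End Symbols.

End Whole.

(** * The two reductions *)

(** [encode] follows the order of [enum]: with patterns varying fastest, the vectors of all [R_E]
    for one [R] are contiguous. *)
Lemma enum_prod (T1 T2 : finType) :
  enum {: T1 * T2} = [seq (x, y) | x <- enum T1, y <- enum T2].
Proof. by rewrite [LHS]enumT unlock. Qed.

(** * Numbering of the tapes, with input first and output last *)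

Section TapeIndex.

Variable X : finType.

Definition tape_of (i : 'I_#|X|.+2) : option (option X) :=
  omap (fun j => omap enum_val (unlift ord_max j)) (unlift ord0 i).

Definition index_of (x : option (option X)) : 'I_#|X|.+2 :=
  if x is Some y then lift ord0 (if y is Some z then lift ord_max (enum_rank z)
                                 else ord_max)
  else ord0.

Lemma index_ofK : cancel index_of tape_of.
Proof.
rewrite /tape_of; case=> [[z|]|] /=; last by rewrite unlift_none.
  by rewrite liftK /= liftK /= enum_rankK.
by rewrite liftK /= unlift_none.
Qed.

Lemma tape_ofK : cancel tape_of index_of.
Proof.
rewrite /tape_of => i; case: unliftP => [j|] -> //=.
by case: unliftP => [z|] -> //=; rewrite enum_valK.
Qed.

Lemma tape_of_last : tape_of ord_max = Some None.
Proof.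
have -> : (ord_max : 'I_#|X|.+2) = index_of (Some None) by apply: val_inj.
exact: index_ofK.
Qed.

End TapeIndex.

(** * Polynomial time bounds *)

Section Complexity.

Variable tau : signature.
Notation K := (width tau).
Notation tape_name := (tape_name tau).
Notation output := (Some None : tape_name).

(** The universe size is at most the input length, so [budget] is bounded by the polynomial
    [5 (X + 1)] to the power [K]. *)
Lemma poly_time_runs (T U : Type) (encT : T -> seq bool) (encU : U -> seq bool)
    (f : T -> U) (c : program tape_name) (C : nat) (n_of : T -> nat) :
  (forall x, n_of x <= size (encT x)) ->
  (forall x, exists2 s,
     runs c (layout (tau := tau) (encT x) 0 (word [::]) 0 false 0 false (fun=> 0%R)) s
       (C * budget tau (n_of x)) &
     (s output).1 = word (encU (f x))) ->
  poly_time encT encU f.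
Proof.
move=> hn hc.
exists (compile (@tape_of _) (@index_of (option ('I_K + 'I_K * 'I_K)%type)) c).
exists (C%:P * (5%:P * ('X + 1%:P)) ^+ K)%R => x.
have [s hs su] := hc x.
apply: (@compile_outputs _ _ _ _ (@index_ofK _) _ s); last by rewrite tape_of_last.
- apply: (@runs_leq _ _ _ _ (C * budget tau (n_of x))).
    rewrite hornerM horner_exp hornerM hornerD hornerX !hornerC !natrE.
    rewrite leq_mul2l; apply/orP; right.
    by rewrite leq_exp2r // leq_mul2l addn1 ltnS hn.
  move: hs; congr runs; apply: functional_extensionality.
  have e : word [::] = fun=> None.
    by apply: functional_extensionality => -[z|z] //=; rewrite nth_nil.
  have t0 : tape_of (X := option ('I_K + 'I_K * 'I_K)%type) ord0 = None.
    by rewrite /tape_of unlift_none.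
  rewrite t0; case=> [[[[i|[i j]]|]|]|]; rewrite /= ?e //.
- exact: can_inj (@tape_ofK _).
Qed.

Lemma leq_budget n k : k <= K -> (5 * n.+1) ^ k <= budget tau n.
Proof. by move=> kK; apply: leq_pexp2l => //; rewrite muln_gt0. Qed.

Lemma linear_budget n : 5 * n.+1 <= budget tau n.
Proof. by rewrite -{1}[5 * n.+1]expn1; apply: leq_budget. Qed.

Lemma size_lex_tuples n k : size (lex_tuples n k) = n ^ k.
Proof.
by elim: k => //= k IHk; rewrite size_allpairs IHk expnS size_enum_ord.
Qed.

(** Bounds the time in which the epilogue may have to erase the output. *)
Lemma size_encode (A : structure tau) :
  size (encode A) <= #|sym tau|.+1 * budget tau (universe_size A).
Proof.
rewrite /encode size_cat size_nseq /=; set n := universe_size A.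
have h : size (flatten [seq [seq t \in interp A R | t <- lex_tuples n (arity R)]
    | R <- enum (sym tau)]) <= #|sym tau| * budget tau n.
  rewrite cardE; elim: (enum _) => //= R Rs IHs.
  rewrite size_cat size_map mulSn leq_add // size_lex_tuples.
  apply: leq_trans (leq_budget n (ltnW (arity_width R))).
  by case: (arity R) => [|k]; rewrite ?expn0 // leq_exp2r; lia.
apply: (@leq_trans (n + (#|sym tau| * budget tau n).+1)); first by rewrite leq_add2l.
rewrite mulSn; have := linear_budget n.
by move: (budget tau n) (#|sym tau| * budget tau n) => B m; lia.
Qed.

Lemma leq_universe (A : structure tau) : universe_size A <= size (encode A).
Proof. by rewrite /encode size_cat size_nseq leq_addr. Qed.

End Complexity.

(** * The maps between structures and their programs *)

Section Reductions.

Variable tau : signature.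
Notation pattern := (pattern tau).
Notation tau' := (refined_sig tau).

Definition split_structure (A : structure tau) : structure tau' :=
  @Structure tau' _ (universe_gt0 A)
    (fun Q => [set t : (arity Q.1).-tuple _ | (t \in interp A Q.1) && (eqpat tau t == Q.2)]).

Definition merge_structure (B : structure tau') : structure tau :=
  @Structure tau _ (universe_gt0 B)
    (fun R => [set t : (arity R).-tuple _ | t \in interp B (R, eqpat tau t)]).

Definition has_collapsed (B : structure tau') : bool :=
  has (fun R => has (fun E =>
      has (fun t : (arity R).-tuple _ => (t \in interp B (R, E)) && collapsed E t)
          (lex_tuples (universe_size B) (arity R)))
    (enum pattern)) (enum (sym tau)).

Lemma mem_lex_tuples n k (t : k.-tuple 'I_n) : t \in lex_tuples n k.
Proof.
elim: k t => [|k IHk] t /=; first by rewrite tuple0 inE.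
case/tupleP: t => x t; apply/allpairsP; exists (x, t).
by rewrite mem_enum IHk.
Qed.

Lemma has_collapsedP (B : structure tau') :
  reflect (exists (Q : sym tau') (t : (arity Q).-tuple 'I_(universe_size B)),
             t \in interp B Q /\ collapsed Q.2 t)
    (has_collapsed B).
Proof.
apply: (iffP hasP) => [[R _ /hasP[E _ /hasP[t _ /andP[tB tc]]]]|[[R E] [t [tB tc]]]].
  by exists (R, E), t.
exists R; first by rewrite mem_enum.
apply/hasP; exists E; first by rewrite mem_enum.
by apply/hasP; exists t; rewrite ?mem_lex_tuples ?tB.
Qed.

Lemma encode_refined_sig (B : structure tau') :
  encode B = nseq (universe_size B) true ++ false ::
    flatten [seq flatten [seq
      [seq t \in interp B (R, E) | t <- lex_tuples (universe_size B) (arity R)]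
      | E <- enum pattern] | R <- enum (sym tau)].
Proof.
rewrite /encode; congr (_ ++ _ :: _); rewrite [enum (sym tau')]enum_prod.
elim: (enum (sym tau)) => //= R Rs IHs.
rewrite map_cat flatten_cat IHs; congr (_ ++ _).
by rewrite -map_comp.
Qed.

Lemma poly_time_split : poly_time (@encode tau) (@encode tau') split_structure.
Proof.
(* The final [+ 2] pays for the prologue and for the empty sequence. *)
apply: (@poly_time_runs tau _ _ _ _ _
  (Seq (prologue tau) (seqs [seq split_symbol tau (arity R) | R <- enum (sym tau)]))
  (#|sym tau| * (#|pattern| * 2 + 2) + 2) (@universe_size tau)) => A.
  exact: leq_universe.
set n := universe_size A.
have h1 : runs (prologue tau) _ (@rest_state tau (encode A) n _ _ _ _) _ :=
  runs_prologue tau n (flatten [seq [seq t \in interp A R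
  | t <- lex_tuples n (arity R)] | R <- enum (sym tau)]).
have [|p' h2] := @runs_split tau (encode A) n (fun R t => t \in interp A R)
  (enum (sym tau)) n.+1 (nseq n true ++ [:: false]) false.
  by rewrite /encode -cat_rcons -cats1 drop_size_cat // size_cat size_nseq addn1.
have sz : size (nseq n true ++ [:: false]) = n.+1 by rewrite size_cat size_nseq addn1.
rewrite sz in h2.
eexists; first apply: (runs_leq _ (runs_seq h1 h2)).
  rewrite -cardE mulnA; have := @linear_budget tau n.
  move: (budget tau n) (_ * (_ * 2 + 2)) => B m hB.
  by rewrite mulnDl; lia.
rewrite encode_refined_sig /=; congr word_tape; rewrite -catA /=.
congr (_ ++ _ :: flatten _); apply: eq_map => R; congr flatten; apply: eq_map => E.
by apply: eq_map => t; rewrite inE.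
Qed.

Lemma poly_time_merge (A0 : structure tau) :
  poly_time (@encode tau') (@encode tau)
    (fun B => if has_collapsed B then A0 else merge_structure B).
Proof.
(* Beyond the passes, [2 * #|sym tau|.+1] pays for erasing and [size (encode A0)] for writing the NO
   instance; the 8 covers the prologue, the empty sequence and the constant 6 of the epilogue. *)
apply: (@poly_time_runs tau _ _ _ _ _
  (Seq (prologue tau)
    (Seq (seqs [seq merge_symbol tau (arity R) | R <- enum (sym tau)])
       (epilogue tau (encode A0))))
  (#|sym tau| * (#|pattern| * 2 + 4) + 2 * #|sym tau|.+1 + size (encode A0) + 8)
  (@universe_size tau')) => B.
  by rewrite /encode size_cat size_nseq leq_addr.
set n := universe_size B.
have h1 : runs (prologue tau) _ (@rest_state tau (nseq n true ++ false :: _) n _ _ _ _) _ :=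
  runs_prologue tau n (flatten [seq flatten [seq
      [seq t \in interp B (R, E) | t <- lex_tuples n (arity R)]
      | E <- enum pattern] | R <- enum (sym tau)]).
have [|p' h2] := @runs_merge tau (encode B) n (fun R E t => t \in interp B (R, E))
  (enum (sym tau)) n.+1 (nseq n true ++ [:: false]) false.
  by rewrite encode_refined_sig -cat_rcons -cats1 drop_size_cat // size_cat size_nseq addn1.
have sz : size (nseq n true ++ [:: false]) = n.+1 by rewrite size_cat size_nseq addn1.
move: h2; rewrite sz orFb -/(has_collapsed B).
have -> : (nseq n true ++ [:: false]) ++ flatten
    [seq [seq t \in interp B (R, eqpat tau t) | t : (arity R).-tuple 'I_n
           <- lex_tuples n (arity R)] | R <- enum (sym tau)] =
    encode (merge_structure B).
  rewrite -catA /=; congr (_ ++ _ :: flatten _); apply: eq_map => R.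
  by apply: eq_map => t; rewrite inE.
move=> h2; rewrite -encode_refined_sig in h1.
have h3 := @runs_epilogue tau (encode B) n p' (encode (merge_structure B)) (encode A0)
  (has_collapsed B).
eexists; first apply: (runs_leq _ (runs_seq h1 (runs_seq h2 h3))).
  rewrite -cardE mulnA.
  have := size_encode (merge_structure B); rewrite -[universe_size _]/n.
  have := @linear_budget tau n.
  move: (budget tau n) (_ * (_ * 2 + 4)) (size (encode _)) => b m x.
  rewrite !mulnDl -mulnA; move: (_.+1 * b) (size _ ) => y z hb hx.
  have : z <= z * b by rewrite leq_pmulr; lia.
  by move: (z * b) => zb; lia.
by case: (has_collapsed B).
Qed.

End Reductions.

Theorem theorem1 (tau : signature) (Phi : SNP tau)
    (Phi_GMMSNPneq : GMMSNPneq Phi) (Phi_nontrivial : nontrivial Phi) :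
  exists (tau' : signature) (Phi' : SNP tau'),
    [/\ MMSNP Phi', nontrivial Phi' & poly_equivalent (Sat Phi) (Sat Phi')].
Proof.
have split_sat (A : structure tau) :
    Sat Phi A <-> Sat (refined_SNP Phi) (split_structure A).
  apply: (refined_models Phi_GMMSNPneq (Ordinal (universe_gt0 A))) => [R t|Q t].
    by rewrite inE eqxx andbT.
  by rewrite inE => /andP[_ /eqP <-]; apply: collapsed_eqpat.
have [[A1 satA1] [A0 nsatA0]] := Phi_nontrivial.
exists (refined_sig tau), (refined_SNP Phi); split; first exact: refined_MMSNP.
  (* YES and NO instances are both transported by [split_structure]. *)
  by split; [exists (split_structure A1)|exists (split_structure A0)]; rewrite -split_sat.
split; first by exists (@split_structure tau); first exact: poly_time_split.
exists (fun B => if has_collapsed B then A0 else merge_structure B).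
  exact: poly_time_merge.
move=> B; case: has_collapsedP => [[Q [t [tB tc]]]|nc].
  (* Both sides are false: [A0] is a NO instance, and the collapsed tuple makes [B] one. *)
  split=> // satB; case: (collapsed_unsat (Ordinal (universe_gt0 B)) tB tc satB).
apply: iff_sym.
(* The model equivalence applies to [B] and its merge, although [B] need not be the split of any
   structure: it only asks that no tuple be collapsed. *)
apply: (refined_models Phi_GMMSNPneq (Ordinal (universe_gt0 B))) => [R t|Q t tB].
  by rewrite inE.
by apply/negP => tc; apply: nc; exists Q, t.
Qed.
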